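(* Let $\Bbbk$ be an infinite $F$-finite field of characteristic $p>0$. Let $g_1,\ldots,g_m\in\Bbbk[x]=\Bbbk[x_1,\ldots,x_n]$ be nonzero polynomials that generate a proper ideal $\mathfrak{a}$, and let $\mathfrak{b}$ be a proper monomial ideal of $\Bbbk[x]$ with $\mathfrak{a}\subseteq\sqrt{\mathfrak{b}}$. Then $\operatorname{crit}^{\mathfrak{b}}(\mathfrak{a})=\max\{\operatorname{c}^{\mathfrak{b}}(g): g\in\mathfrak{a},\ g\ne 0\}$ (in particular the maximum is attained).
   Context: A ring $S$ of characteristic $p$ is $F$-finite if it is a finitely generated module over $S^p$. Below $q$ ranges over powers $p^e$, $e\ge 0$. Let $S$ be an $F$-finite regular domain of characteristic $p$, and $\mathfrak{a},\mathfrak{b}$ nonzero proper ideals of $S$ with $\mathfrak{a}\subseteq\sqrt{\mathfrak{b}}$. Put $\mathfrak{a}^{[q]}=\langle f^q:f\in\mathfrak{a}\rangle$, and for $k\in\mathbb{N}$ with base $p$ expansion $k=k_0+k_1p+\cdots+k_rp^r$, $\mathfrak{a}^{[k]}=\mathfrak{a}^{k_0}(\mathfrak{a}^{k_1})^{[p]}\cdots(\mathfrak{a}^{k_r})^{[p^r]}$ (with $\mathfrak{a}^0=S$). The $F$-threshold of $\mathfrak{a}$ with respect to $\mathfrak{b}$ is $\operatorname{c}^{\mathfrak{b}}(\mathfrak{a})=\lim_{q\to\infty}\nu(q)/q=\sup_q\nu(q)/q$ with $\nu(q)=\max\{k\in\mathbb{N}:\mathfrak{a}^k\not\subseteq\mathfrak{b}^{[q]}\}$,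 and $\operatorname{c}^{\mathfrak{b}}(f)=\operatorname{c}^{\mathfrak{b}}(\langle f\rangle)$. The critical (Frobenius) exponent of $\mathfrak{a}$ with respect to $\mathfrak{b}$ is $\operatorname{crit}^{\mathfrak{b}}(\mathfrak{a})=\lim_{q\to\infty}\mu(q)/q=\sup_q\mu(q)/q$ with $\mu(q)=\max\{k\in\mathbb{N}:\mathfrak{a}^{[k]}\not\subseteq\mathfrak{b}^{[q]}\}$. *)

(* Defs.v *)
From HB Require Import structures.
From mathcomp Require Import all_boot all_order all_algebra.
From mathcomp Require Import all_classical all_reals.
From mathcomp Require Import topology normedtype sequences.
(* The notations of mpoly clash with those of MathComp-Analysis: [mpoly n K]
   is the ring of polynomials in n variables over K, and [mpolyX K u] is the
   monomial with exponent vector u. *)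
From mathcomp Require mpoly.
Import -(notations) mpoly.

Set Implicit Arguments.
Unset Strict Implicit.
Unset Printing Implicit Defensive.

Import Order.TTheory GRing.Theory Num.Theory.
Import numFieldNormedType.Exports.
Local Open Scope classical_set_scope.
Local Open Scope ring_scope.

(* The set of maxima of A, empty or a singleton. *)
Definition is_maximum d (T : porderType d) (A : set T) : set T :=
  A `&` ubound A.

(* The maximum of a set of natural numbers; 0 if there is none. *)
Definition natmax (A : set nat) : nat := xget 0%N (is_maximum A).

(* S is generated by finitely many elements as a module over S^p. *)
Definition F_finite (p : nat) (S : comNzRingType) : Prop :=
  exists (r : nat) (e : 'I_r -> S), forall x : S,
    exists c : 'I_r -> S, x = \sum_(i < r) c i ^+ p * e i.

Section Ideals.
Variable S : comNzRingType.
Implicit Types I J : set S.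

Definition is_ideal I : Prop :=
  [/\ I 0, forall x y, I x -> I y -> I (x + y) & forall c x, I x -> I (c * x)].

Definition ideal_gen (A : set S) : set S := smallest is_ideal A.

Definition ideal_mul I J : set S :=
  ideal_gen [set z | exists x y, [/\ I x, J y & z = x * y]].

Definition ideal_pow I (k : nat) : set S := iter k (ideal_mul I) setT.

Definition radical I : set S := [set f | exists N : nat, I (f ^+ N)].

(* I^[q] *)
Definition frob_pow I (q : nat) : set S := ideal_gen [set f ^+ q | f in I].

(* The digit of p^i in the base p expansion of k is (k %/ p ^ i) %% p, and the
   leading digit of k > 0 is at i = trunc_log p k. *)
Definition base_pow (p : nat) I (k : nat) : set S :=
  \big[ideal_mul/setT]_(i < (trunc_log p k).+1)
    frob_pow (ideal_pow I ((k %/ p ^ i) %% p)%N) (p ^ i)%N.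

Definition nu (a b : set S) (q : nat) : nat :=
  natmax [set k | ~ (ideal_pow a k `<=` frob_pow b q)].

Definition mu (p : nat) (a b : set S) (q : nat) : nat :=
  natmax [set k | ~ (base_pow p a k `<=` frob_pow b q)].

Definition F_threshold (R : realType) (p : nat) (b a : set S) : R :=
  limn (fun e : nat => (nu a b (p ^ e)%N)%:R / (p ^ e)%:R : R).

Definition crit_exponent (R : realType) (p : nat) (b a : set S) : R :=
  limn (fun e : nat => (mu p a b (p ^ e)%N)%:R / (p ^ e)%:R : R).

End Ideals.

Definition monomial_ideal (n : nat) (K : fieldType) (b : set (mpoly n K)) : Prop :=
  exists M : set (multinom n), b = ideal_gen [set mpolyX K u | u in M].

(* Main.v *)
Require Import Defs.
From HB Require Import structures.
From mathcomp Require Import all_boot all_order all_algebra.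
From mathcomp Require Import all_classical all_reals.
From mathcomp Require Import topology normedtype sequences.
From mathcomp Require mpoly.
Import -(notations) mpoly.

Set Implicit Arguments.
Unset Strict Implicit.
Unset Printing Implicit Defensive.

Import Order.TTheory GRing.Theory Num.Theory.
Import numFieldNormedType.Exports.
Local Open Scope classical_set_scope.
Local Open Scope ring_scope.

(* Write f_t for the linear combination of the generators with coefficients t.

   Polarization: since K is infinite, a^[k] is contained in an ideal B as soon as
   every f_t ^+ k is in B.  Hence mu(q) is the maximum of the nu_{f_t}(q), attained
   at some t depending on q, and it remains to choose t uniformly in q.

   Finiteness: as b is monomial, membership in b^[q] can be tested coefficientwise,
   and nu_f(p^e) consists of the first base p digits of the threshold of f.  For f
   of degree at most d, at most N tails of this digit sequence are distinct, where N
   is the number of monomials of degree at most d.  So the f_t have only finitely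
   many digit sequences, one of which agrees with that of mu(q) for infinitely many
   q, hence for all q. *)

(** * Ideals and their ordinary, Frobenius and base [p] powers *)

Section IdealTheory.
Variable S : comNzRingType.
Implicit Types (A I J B : set S).

Lemma ideal_gen_ideal A : is_ideal (ideal_gen A).
Proof.
split=> [J [[]]//|x y Ax Ay J JA|c x Ax J JA].
  by case: (JA) => -[_ JD _] _; apply: JD; [exact: Ax|exact: Ay].
by case: (JA) => -[_ _ JM] _; apply: JM; exact: Ax.
Qed.

Lemma ideal_gen_mem A x : A x -> ideal_gen A x.
Proof. exact: sub_gen_smallest. Qed.

Lemma ideal_gen_min A B x : is_ideal B -> A `<=` B -> ideal_gen A x -> B x.
Proof. by move=> Bid AB; apply: smallest_sub. Qed.

Lemma ideal_colon B y : is_ideal B -> is_ideal [set x | B (x * y)].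
Proof.
move=> [B0 BD BM]; split=> [|u v|c u] /=; first by rewrite mul0r.
  by rewrite mulrDl; exact: BD.
by rewrite -mulrA; exact: BM.
Qed.

Lemma ideal_mulM I J x y : I x -> J y -> ideal_mul I J (x * y).
Proof. by move=> Ix Jy; apply: ideal_gen_mem; exists x, y. Qed.

Lemma ideal_pow_exp I f k : I f -> ideal_pow I k (f ^+ k).
Proof.
move=> If; elim: k => [//|k IHk]; rewrite exprS /ideal_pow iterS.
exact: ideal_mulM.
Qed.

Lemma frob_pow_exp I f q : I f -> frob_pow I q (f ^+ q).
Proof. by move=> If; apply: ideal_gen_mem; exists f. Qed.

Lemma ideal_pow1_sub B f k : is_ideal B ->
  ideal_pow (ideal_gen [set f]) k `<=` B <-> B (f ^+ k).
Proof.
move=> Bid; split=> [sub|Bf].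
  by apply: sub; apply: ideal_pow_exp; exact: ideal_gen_mem.
elim: k B Bid Bf => [|k IHk] B Bid Bf x.
  by move=> _; rewrite -[x]mulr1; case: Bid => _ _; apply.
rewrite /ideal_pow iterS; apply: ideal_gen_min => // _ [y [z [fy fz ->]]].
rewrite mulrC; apply: (IHk _ (ideal_colon y Bid)) fz => /=; rewrite mulrC.
apply: (ideal_gen_min (ideal_colon (f ^+ k) Bid)) fy => _ -> /=.
by rewrite -exprS.
Qed.

Variable p : nat.

(** Cutting [k] into base [p] digits factors [f ^+ k] into pieces, one in each factor of the product
    that defines [base_pow]. *)
Lemma base_pow_exp I f k : (1 < p)%N -> I f -> base_pow p I k (f ^+ k).
Proof.
move=> p_gt1 If; pose F i := frob_pow (ideal_pow I ((k %/ p ^ i) %% p)%N) (p ^ i)%N.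
rewrite /base_pow -(big_mkord xpredT F) /=.
(* Induction on the number [l] of digits read from position [j] on; the higher digits stay behind as
   a power of [f]. *)
suff H l j : exists2 x, (\big[@ideal_mul S/setT]_(j <= i < j + l) F i) x &
    f ^+ (k %/ p ^ j * p ^ j) = x * f ^+ (k %/ p ^ (j + l) * p ^ (j + l)).
  have [x Fx] := H (trunc_log p k).+1 0; rewrite divn1 muln1 => ->.
  by rewrite divn_small ?mul0n ?expr0 ?mulr1 // trunc_log_ltn.
elim: l j => [|l IHl] j.
  by exists 1; rewrite ?addn0 ?mul1r // big_geq.
have [x Fx Ex] := IHl j.+1.
exists (f ^+ ((k %/ p ^ j) %% p) ^+ (p ^ j) * x).
  rewrite big_ltn -addSnnS ?leq_addr //; apply: ideal_mulM => //.
  by apply: frob_pow_exp; exact: ideal_pow_exp.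
rewrite -addSnnS -mulrA -Ex -!exprM -exprD; congr (_ ^+ _).
by rewrite {1}(divn_eq (k %/ p ^ j) p) -divnMA -expnSr mulnDl -mulnA -expnS addnC.
Qed.

Hypothesis charS : p \in [pchar S].

Lemma exprD_pow (x y : S) e : (x + y) ^+ (p ^ e) = x ^+ (p ^ e) + y ^+ (p ^ e).
Proof.
have p_pr := pcharf_prime charS.
by apply: exprDn_pchar; rewrite pnatX pnatE ?charS.
Qed.

(** Additivity of Frobenius is what makes this an ideal; it lets statements about [x ^+ (p ^ e)] be
    checked on generators only. *)
Lemma ideal_preim_pow B y e :
  is_ideal B -> is_ideal [set x | B (x ^+ (p ^ e) * y)].
Proof.
have p_gt0 := prime_gt0 (pcharf_prime charS).
move=> [B0 BD BM]; split=> [|u v|c u] /=.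
- by rewrite expr0n expn_eq0 -leqn0 leqNgt p_gt0 mul0r.
- by rewrite exprD_pow mulrDl; exact: BD.
- by rewrite exprMn -mulrA; exact: BM.
Qed.

Lemma frob_pow_sub B A e : is_ideal B ->
  frob_pow (ideal_gen A) (p ^ e) `<=` B <-> forall x, A x -> B (x ^+ (p ^ e)).
Proof.
move=> Bid; split=> [sub x Ax|AB].
  by apply: sub; apply: frob_pow_exp; exact: ideal_gen_mem.
apply: smallest_sub => // _ [x Ax <-]; rewrite -[_ ^+ _]mulr1.
apply: (ideal_gen_min (ideal_preim_pow 1 e Bid)) Ax => z Az /=.
by rewrite mulr1; exact: AB.
Qed.

End IdealTheory.

(** * Polarization over an infinite field *)

Section Polarization.
Variables (K : fieldType) (S : comAlgType K).
Hypothesis infK : infinite_set [set: K].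
Implicit Types B : set S.

Lemma ideal_scale B c x : is_ideal B -> B x -> B (c *: x).
Proof. by move=> [_ _ BM] Bx; rewrite -[x]mul1r scalerAl; exact: BM. Qed.

(* Vector-valued interpolation: inverting a Vandermonde matrix recovers the
   coefficients from the values at [N] distinct points. *)
Lemma poly_coef_in B (T : set K) N (v : 'I_N -> S) :
  is_ideal B -> infinite_set T ->
  (forall s, T s -> B (\sum_(i < N) s ^+ i *: v i)) -> forall i, B (v i).
Proof.
move=> Bid infT Bv i; have [B0 BD BM] := Bid.
have [F FT sizeF] := infinite_set_fset N infT.
pose r : 'rV[K]_N := \row_j nth 0 (finmap.enum_fset F) j.
have inF (j : 'I_N) : r 0 j \in finmap.enum_fset F by rewrite mxE mem_nth // (leq_trans _ sizeF).
have unitV : Vandermonde N r \in unitmx.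
  rewrite unitmxE unitfE det_Vandermonde; apply/prodf_neq0 => j _.
  apply/prodf_neq0 => l jl; rewrite subr_eq0 !mxE nth_uniq ?finmap.fset_uniq //.
  - by rewrite gtn_eqF.
  - by rewrite (leq_trans _ sizeF).
  - by rewrite (leq_trans _ sizeF).
pose W := invmx (Vandermonde N r).
have -> : v i = \sum_j W j i *: \sum_(l < N) (r 0 j) ^+ l *: v l.
  under eq_bigr do rewrite scaler_sumr; rewrite exchange_big /=.
  transitivity (\sum_(l < N) ((1%:M : 'M[K]_N) l i) *: v l).
    rewrite (bigD1 i) //= mxE eqxx scale1r big1 ?addr0 // => l li.
    by rewrite mxE (negPf li) scale0r.
  apply: eq_bigr => l _; rewrite -(mulmxV unitV) mxE scaler_suml.
  by apply: eq_bigr => j _; rewrite !mxE scalerA mulrC.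
elim/big_ind: _ => // j _; apply: ideal_scale => //; apply: Bv.
by apply: FT; exact: inF.
Qed.

Variable p : nat.
Hypothesis charK : p \in [pchar K].
Let charS : p \in [pchar S]. Proof. by rewrite pchar_lalg. Qed.

(** Polarization at level [e] sees a parameter [s] only through [s ^+ (p ^ e)], so the interpolation
    points come from this image. Frobenius is injective on a field. *)
Lemma infinite_pow_image e : infinite_set [set s ^+ (p ^ e) | s in [set: K]].
Proof.
have inj : injective (fun s : K => s ^+ (p ^ e)).
  move=> s t /eqP st; apply/eqP; rewrite -subr_eq0.
  have : (s - t) ^+ (p ^ e) == 0.
    have := exprD_pow charK (s - t) t e; rewrite subrK (eqP st).
    by move=> /eqP; rewrite -subr_eq0 opprD addrCA subrr addr0 oppr_eq0.
  by rewrite expf_eq0 => /andP[].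
move=> fin; apply: infK; apply: sub_finite_set (finite_preimage _ fin).
  by move=> s _; exists s.
by move=> s t _ _; exact: inj.
Qed.

Variables A B : set S.
Hypothesis A_lin : forall f h (s : K), A f -> A h -> A (f + s *: h).
Hypothesis A0 : A 0.
Hypothesis B_ideal : is_ideal B.

(* The coefficient of [s ^+ (p ^ j)] in the expansion of
   [(f + s *: h) ^+ (M * p ^ j) = (f ^+ (p ^ j) + s ^+ (p ^ j) *: h ^+ (p ^ j)) ^+ M]
   is [M] times the product below. *)
Lemma polarization_step M j y h : ~~ (p %| M)%N -> A h ->
  (forall f, A f -> B (f ^+ (M * p ^ j) * y)) ->
  forall f, A f -> B (f ^+ (M.-1 * p ^ j) * (h ^+ (p ^ j) * y)).
Proof.
move=> pM Ah By f Af; case: M => [|M] in pM By *; first by rewrite dvdn0 in pM.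
set P := (p ^ j)%N in By *.
pose v (i : 'I_M.+2) := (f ^+ P) ^+ (M.+1 - i) * (h ^+ P) ^+ i *+ 'C(M.+1, i) * y.
have Bv : forall i, B (v i).
  apply: (poly_coef_in B_ideal (@infinite_pow_image j)) => _ [s _ <-].
  have := By _ (A_lin s Af Ah); rewrite mulnC exprM exprD_pow // exprDn mulr_suml.
  congr B; apply: eq_bigr => i _; rewrite exprZn exprZn.
  by rewrite /v -/P -scalerAr scalerMnr -scalerAl.
(* This index is 1, where the binomial coefficient is [M.+1], a unit of [K] because [p] does not
   divide it. *)
have := Bv (lift ord0 ord0); rewrite /v /= /bump /= add1n subSS subn0 bin1 expr1.
move=> /(ideal_scale (M.+1)%:R^-1 B_ideal).
rewrite -scaler_nat -scalerAl scalerA mulVf ?scale1r.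
  by rewrite mulnC exprM mulrA.
by rewrite -(dvdn_pcharf charK).
Qed.

Variable G : set S.
Hypothesis GA : G `<=` A.

(** Each of the [r] factors of [x] is split off by one [polarization_step]. The bound on [r] ensures
    that none of the exponents [N], ..., [N - r + 1] met on the way is divisible by [p]. *)
Lemma polarization_pow N j y r x : (r <= N %% p)%N ->
  (forall f, A f -> B (f ^+ (N * p ^ j) * y)) ->
  ideal_pow (ideal_gen G) r x ->
  forall f, A f -> B (f ^+ ((N - r) * p ^ j) * (x ^+ (p ^ j) * y)).
Proof.
move=> rN By; elim: r x rN => [|r IHr] x rN.
  move=> _ f Af; rewrite subn0 mulrCA.
  by have [_ _ BM] := B_ideal; apply: BM; exact: By.
rewrite /ideal_pow iterS => xG f Af; rewrite mulrCA.
apply: (ideal_gen_min (ideal_preim_pow charS _ j B_ideal)) xG.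
move=> _ [h [z [Gh Gz ->]]] /=.
have H := IHr z (ltnW rN) Gz.
have pNr : ~~ (p %| N - r)%N.
  have p_gt0 := prime_gt0 (pcharf_prime charK).
  rewrite {1}(divn_eq N p) -addnBA ?(ltnW rN) // dvdn_addr ?dvdn_mull //.
  rewrite gtnNdvd ?subn_gt0 // (leq_ltn_trans (leq_subr _ _)) //.
  by rewrite ltn_pmod.
rewrite exprMn -mulrA subnS.
apply: (ideal_gen_min (ideal_preim_pow charS _ j B_ideal)) Gh => w Gw /=.
by rewrite [z ^+ _ * _]mulrCA [X in B X]mulrCA; apply: polarization_step => //; exact: GA.
Qed.

(** Digits are consumed from the lowest up: polarizing as many times as the digit at position [j]
    says turns the exponent [k %/ p ^ j * p ^ j] into [k %/ p ^ j.+1 * p ^ j.+1]. *)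
Lemma base_pow_sub k : (forall f, A f -> B (f ^+ k)) ->
  base_pow p (ideal_gen G) k `<=` B.
Proof.
have p_gt1 := prime_gt1 (pcharf_prime charK).
have p_gt0 := ltnW p_gt1.
have [B0 BD BM] := B_ideal.
move=> BA x.
pose F i := frob_pow (ideal_pow (ideal_gen G) ((k %/ p ^ i) %% p)%N) (p ^ i)%N.
rewrite /base_pow -(big_mkord xpredT F) /=.
(* Here [y] collects the factors already split off at positions below [j]. *)
suff H l j y : (forall f, A f -> B (f ^+ (k %/ p ^ j * p ^ j) * y)) ->
    forall z, (\big[@ideal_mul S/setT]_(j <= i < j + l) F i) z ->
    forall f, A f -> B (f ^+ (k %/ p ^ (j + l) * p ^ (j + l)) * (z * y)).
  have B1 f : A f -> B (f ^+ (k %/ p ^ 0 * p ^ 0) * 1).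
    by move=> Af; rewrite divn1 muln1 mulr1; exact: BA.
  (* All digits are used up, so the remaining power of [f] has exponent 0 and any element of [A]
     serves as [f]. *)
  move=> /(H _ _ _ B1) /(_ 0 A0).
  by rewrite divn_small ?mul0n ?expr0 ?mul1r ?mulr1 // trunc_log_ltn.
elim: l j y => [|l IHl] j y By z.
  by move=> _ f Af; rewrite addn0 mulrCA; apply: BM; exact: By.
rewrite big_ltn -addSnnS ?leq_addr // => Fz f Af.
set c := f ^+ _; rewrite mulrCA.
apply: (ideal_gen_min (ideal_colon (c * y) B_ideal)) Fz.
move=> _ [z1 [z2 [Fz1 Fz2 ->]]] /=; rewrite -mulrA.
apply: (ideal_gen_min (ideal_colon (z2 * (c * y)) B_ideal)) Fz1.
move=> _ [w Gw <-] /=; rewrite [z2 * _]mulrCA [X in B X]mulrCA [w ^+ _ * _]mulrCA.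
apply: IHl Fz2 _ Af => g Ag; have := polarization_pow (leqnn _) By Gw Ag.
rewrite {1}(divn_eq (k %/ p ^ j) p) addnK.
by rewrite -divnMA -expnSr -mulnA -expnS.
Qed.

End Polarization.

(** The [N + 1] vectors satisfy a nontrivial linear relation. Among those with nonzero coefficient,
    the one with smallest [k] is a combination of the others, which all lie in its [J i]. *)
Lemma filtered_pigeonhole (K : fieldType) N (v : 'I_N.+1 -> 'rV[K]_N)
    (J : 'I_N.+1 -> set 'rV[K]_N) (k : 'I_N.+1 -> nat) :
    injective k ->
    (forall i, [/\ J i 0, forall x y, J i x -> J i y -> J i (x + y) &
                   forall c x, J i x -> J i (c *: x)]) ->
    (forall i j, (k i < k j)%N -> J i (v j)) ->
  exists i, J i (v i).
Proof.
move=> k_inj J_sub Jv; pose M := \matrix_i v i.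
have : kermx M != 0.
  by rewrite kermx_eq0 /row_free neq_ltn ltnS rank_leq_col.
move=> /rowV0Pn[c /sub_kermxP cM c_neq0].
have /existsP[i0 ci0] : [exists i, c 0 i != 0].
  apply: contraNT c_neq0 => /existsPn c0; apply/eqP/rowP => i; rewrite mxE.
  by apply/eqP; move: (c0 i); rewrite negbK.
pose i := [arg min_(i < i0 | c 0 i != 0) k i].
have [ci i_min] : c 0 i != 0 /\ forall j, c 0 j != 0 -> (k i <= k j)%N.
  by rewrite /i; case: arg_minnP.
exists i; have [J0 JD JZ] := J_sub i.
have : \sum_j c 0 j *: v j = 0.
  by rewrite -[RHS]cM mulmx_sum_row; apply: eq_bigr => j _; rewrite rowK.
rewrite (bigD1 i) //= => /eqP; rewrite addr_eq0 => /eqP civ.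
have -> : v i = (c 0 i)^-1 *: (-1 *: \sum_(j | j != i) c 0 j *: v j).
  by rewrite scaleN1r -civ scalerA mulVf // scale1r.
apply: (JZ); apply: (JZ); elim/big_ind: _ => // j ji.
have [->|cj] := eqVneq (c 0 j) 0; first by rewrite scale0r.
apply: JZ; apply: Jv; rewrite ltn_neqAle i_min // andbT.
by apply: contraNneq ji => /k_inj ->.
Qed.

(** * Frobenius powers of monomial ideals and coefficientwise membership *)

Section MonomialIdeals.
Variables (K : fieldType) (n : nat) (M : set (multinom n)).
Implicit Types (f g h : mpoly n K) (u v w : multinom n).

Definition frob_divides q u :=
  exists2 m, M m & forall i : 'I_n, (q * m i <= u i)%N.

(** For [q] a power of [p] this is the Frobenius power of the ideal generated by the monomials in
    [M]; see [frob_pow_monomial]. *)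
Definition frob_monomial q : set (mpoly n K) :=
  [set f | forall u, mcoeff u f != 0 -> frob_divides q u].

Lemma mcoeffXM u v f :
  mcoeff u (mpolyX K v * f) = if lem v u then mcoeff (mnm_sub u v) f else 0.
Proof.
rewrite mulrC; case: ifPn => [vu|vu].
  by rewrite -{1}(submK vu) addmC mcoeffMX.
apply/eqP; rewrite mcoeff_eq0 (perm_mem (msuppMX f v)).
by apply: contraNN vu => /mapP[m' _ ->]; exact: lem_addr.
Qed.

Lemma frob_monomial_ideal q : is_ideal (frob_monomial q).
Proof.
have JD f g : frob_monomial q f -> frob_monomial q g -> frob_monomial q (f + g).
  move=> Jf Jg u; rewrite mcoeffD.
  have [->|fu _] := eqVneq (mcoeff u f) 0; first by rewrite add0r; exact: Jg.
  exact: Jf.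
have J0 : frob_monomial q 0 by move=> u; rewrite mcoeff0 eqxx.
split=> // c f Jf; rewrite [c]mpolyE mulr_suml.
elim/big_ind: _ => // v _ u; rewrite -scalerAl mcoeffZ mcoeffXM.
case: ifP => [/mnm_lepP vu|_]; last by rewrite mulr0 eqxx.
rewrite mulf_eq0 negb_or => /andP[_ /Jf[m Mm mu]]; exists m => // i.
by apply: leq_trans (mu i) _; rewrite mnmBE leq_subr.
Qed.

Variable p : nat.
Hypothesis charK : p \in [pchar K].
Let p_gt0 : (0 < p)%N := prime_gt0 (pcharf_prime charK).
Let charS : p \in [pchar (mpoly n K)]. Proof. by rewrite pchar_lalg. Qed.

Lemma frobenius_mpolyE h L : h ^+ (p ^ L) =
  \sum_(v <- msupp h) mcoeff v h ^+ (p ^ L) *: mpolyX K (mnm_muln v (p ^ L)).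
Proof.
rewrite [X in X ^+ _]mpolyE.
rewrite (big_morph (fun x : mpoly n K => x ^+ (p ^ L)) (id1 := 0) (op1 := +%R)).
- by apply: eq_bigr => v _; rewrite exprZn mpolyXn.
- by move=> x y; rewrite exprD_pow.
- by rewrite expr0n expn_eq0 -leqn0 leqNgt p_gt0.
Qed.

Lemma frob_pow_monomial e :
  frob_pow (ideal_gen [set mpolyX K u | u in M]) (p ^ e) =
  frob_monomial (p ^ e).
Proof.
apply/seteqP; split.
  apply/(frob_pow_sub charS _ _ (frob_monomial_ideal _)) => _ [m Mm <-] u.
  rewrite mpolyXn mcoeffX.
  have [<- _|_] := eqVneq (mnm_muln m (p ^ e)) u; last by rewrite eqxx.
  by exists m => // i; rewrite mulmnE mulnC.
move=> f Jf; rewrite [f]mpolyE.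
have [I0 ID IM] := ideal_gen_ideal
  [set x ^+ (p ^ e) | x in ideal_gen [set mpolyX K u | u in M]].
rewrite big_seq; elim/big_ind: _ => // u; rewrite mcoeff_msupp => /Jf[m Mm mu].
have lemu : lem (mnm_muln m (p ^ e)) u.
  by apply/mnm_lepP => i; rewrite mulmnE mulnC.
rewrite -(submK lemu) mpolyXD -mpolyXn scalerAl; apply: IM.
by apply: frob_pow_exp; apply: ideal_gen_mem; exists m.
Qed.

(** All exponents of [h ^+ (p ^ L)] are multiples of [p ^ L], so multiplying by it shifts the
    quotient [u] of an exponent and keeps its remainder [w]. *)
Lemma mcoeff_frobM L h f u w : (forall i, w i < p ^ L)%N ->
  mcoeff (mnm_add (mnm_muln u (p ^ L)) w) (h ^+ (p ^ L) * f) =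
  \sum_(v <- msupp h)
    if lem v u then mcoeff v h ^+ (p ^ L) *
      mcoeff (mnm_add (mnm_muln (mnm_sub u v) (p ^ L)) w) f else 0.
Proof.
move=> wL; have P_gt0 : (0 < p ^ L)%N by rewrite expn_gt0 p_gt0.
rewrite frobenius_mpolyE mulr_suml raddf_sum; apply: eq_bigr => v _ /=.
rewrite -scalerAl mcoeffZ mcoeffXM.
have -> : lem (mnm_muln v (p ^ L)) (mnm_add (mnm_muln u (p ^ L)) w) = lem v u.
  apply: eq_forallb => i; rewrite mnmDE !mulmnE -leq_divRL //.
  by rewrite divnMDl // (divn_small (wL i)) addn0.
case: ifP => [/mnm_lepP vu|_]; last by rewrite mulr0.
congr (_ * mcoeff _ _); apply/mnmP => i.
by rewrite !(mnmBE, mnmDE, mulmnE) mulnBl addnBAC // leq_mul2r vu orbT.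
Qed.

Lemma frob_dividesM q L u w : (forall i, w i < p ^ L)%N ->
  frob_divides (q * p ^ L) (mnm_add (mnm_muln u (p ^ L)) w) <-> frob_divides q u.
Proof.
move=> wL; have P_gt0 : (0 < p ^ L)%N by rewrite expn_gt0 p_gt0.
suff E m i : (q * p ^ L * m <= mnm_add (mnm_muln u (p ^ L)) w i)%N = (q * m <= u i)%N.
  by split=> -[m Mm mu]; exists m => // i; [rewrite -E|rewrite E].
rewrite mnmDE mulmnE mulnAC -leq_divRL //.
by rewrite divnMDl // (divn_small (wL i)) addn0.
Qed.

Lemma mnm_divn_eq L u : exists v w,
  (forall i, w i < p ^ L)%N /\ u = mnm_add (mnm_muln v (p ^ L)) w.
Proof.
exists (Multinom (mktuple (fun i => u i %/ p ^ L)%N)).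
exists (Multinom (mktuple (fun i => u i %% p ^ L)%N)).
split=> [i|]; first by rewrite mnmE ltn_pmod // expn_gt0 p_gt0.
by apply/mnmP => i; rewrite mnmDE mulmnE !mnmE -divn_eq.
Qed.

(** Frobenius scales the exponents of [h] by [p ^ L] and raises its coefficients to that power, so
    no terms cancel. *)
Lemma frob_monomial_frob q L h :
  frob_monomial (q * p ^ L) (h ^+ (p ^ L)) <-> frob_monomial q h.
Proof.
have P_gt0 : (0 < p ^ L)%N by rewrite expn_gt0 p_gt0.
split=> Jh.
  move=> u hu; apply/(frob_dividesM q (L := L) u (w := mnm0)).
    by move=> i; rewrite mnm0E.
  apply: Jh; rewrite -[_ ^+ _]mulr1 mcoeff_frobM; last by move=> i; rewrite mnm0E.
  rewrite (bigD1_seq u) ?msupp_uniq ?mcoeff_msupp //= lepm_refl.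
  rewrite big1 ?addr0 => [|v vu].
    rewrite mcoeff1 addm0 (_ : mnm_muln _ _ = mnm0) ?eqxx ?mulr1 ?expf_neq0 //.
    by apply/mnmP => i; rewrite mulmnE mnmBE subnn mul0n mnm0E.
  case: ifP => // /mnm_lepP vleu; rewrite mcoeff1 addm0; case: eqP => [E|_]; last by rewrite mulr0.
  case/eqP: vu; apply/mnmP => i; apply/eqP; rewrite eqn_leq vleu /=.
  move/mnmP/(_ i)/eqP: E; rewrite mulmnE mnmBE mnm0E muln_eq0 subn_eq0.
  by rewrite (gtn_eqF P_gt0) orbF.
have [J0 JD JM] := frob_monomial_ideal (q * p ^ L).
rewrite frobenius_mpolyE big_seq; elim/big_ind: _ => // v.
rewrite mcoeff_msupp => /Jh[m Mm mv] u; rewrite mcoeffZ mcoeffX.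
have [<- _|_] := eqVneq (mnm_muln v (p ^ L)) u; last by rewrite mulr0 eqxx.
by exists m => // i; rewrite mulmnE mulnAC leq_mul2r mv orbT.
Qed.

Definition mdeg_le d f := forall u, mcoeff u f != 0 -> (mdeg u <= d)%N.

Lemma mdeg_le_exp d f k : mdeg_le d f -> mdeg_le (k * d) (f ^+ k).
Proof.
move=> fd; elim: k => [|k IHk] u.
  by rewrite expr0 mcoeff1; have [->|] := eqVneq u mnm0; rewrite ?mdeg0 ?eqxx.
rewrite exprS -mcoeff_msupp => /msuppM_le /allpairsP[[v w] /= [vf wf ->]].
by rewrite mdegD mulSn leq_add ?fd ?IHk -?mcoeff_msupp.
Qed.

Section Components.
Variable d : nat.
Notation N := #|{: bmultinom n d.+1}|.

(* The rows of length [N] are the polynomials of degree at most [d]; [row_coef]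
   reads off their coefficients.  Writing [f] as the sum over [w] of
   [G_w(x^Q) * x^w] with [Q = p ^ L], the component [G_w] is [component L w f]. *)
Definition row_coef (y : 'rV[K]_N) u : K :=
  if insub u is Some b then y 0 (enum_rank (b : bmultinom n d.+1)) else 0.

Definition component L w f : 'rV[K]_N :=
  \row_j mcoeff (mnm_add (mnm_muln (enum_val j : bmultinom n d.+1) (p ^ L)) w) f.

(* [h ^+ (p ^ L)] times the polynomial [y(x ^ (p ^ L))] lies in
   [frob_monomial (q * p ^ L)]. *)
Definition colon_row q L h : set 'rV[K]_N :=
  [set y | forall u, ~ frob_divides q u -> \sum_(v <- msupp h)
    (if lem v u then mcoeff v h ^+ (p ^ L) * row_coef y (mnm_sub u v) else 0) = 0].

Lemma colon_row_subspace q L h : [/\ colon_row q L h 0,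
  forall x y, colon_row q L h x -> colon_row q L h y -> colon_row q L h (x + y) &
  forall c x, colon_row q L h x -> colon_row q L h (c *: x)].
Proof.
split=> [u _|x y Jx Jy u qu|c x Jx u qu].
- apply: big1 => v _; case: ifP => // _; rewrite /row_coef.
  by case: insub => [b|]; rewrite ?mxE mulr0.
- rewrite -[RHS]addr0 -[X in _ = X + _](Jx u qu) -[X in _ = _ + X](Jy u qu).
  rewrite -big_split; apply: eq_bigr => v _ /=.
  case: ifP => _; rewrite ?addr0 // -mulrDr /row_coef.
  by case: insub => [b|]; rewrite ?mxE ?addr0.
- rewrite -[RHS](mulr0 c) -[X in _ = _ * X](Jx u qu) big_distrr; apply: eq_bigr => v _ /=.
  case: ifP => _; rewrite ?mulr0 // mulrCA /row_coef.
  by case: insub => [b|]; rewrite ?mxE ?mulr0.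
Qed.

(** The degree bound makes the coefficients that do not fit into the row vanish. *)
Lemma row_coef_component L w f u : mdeg_le (p ^ L * d) f ->
  row_coef (component L w f) u = mcoeff (mnm_add (mnm_muln u (p ^ L)) w) f.
Proof.
have P_gt0 : (0 < p ^ L)%N by rewrite expn_gt0 p_gt0.
move=> fd; rewrite /row_coef; case: insubP => [b _ <-|ud].
  by rewrite mxE enum_rankK.
apply/esym/eqP; apply: contraNT ud => /fd; rewrite mdegD mdegMn ltnS => ub.
by rewrite -(leq_pmul2l P_gt0) mulnC (leq_trans _ ub) ?leq_addr.
Qed.

(** Exponents with different remainders modulo [p ^ L] do not interact, so membership splits into
    one linear condition for each remainder [w]. *)
Lemma frob_monomial_component q L h f : mdeg_le (p ^ L * d) f ->
  frob_monomial (q * p ^ L) (h ^+ (p ^ L) * f) <->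
  forall w, (forall i, w i < p ^ L)%N -> colon_row q L h (component L w f).
Proof.
move=> fd; split=> [Jhf w wL u qu|Jhf t].
  under eq_bigr do rewrite row_coef_component //.
  rewrite -mcoeff_frobM //; apply/eqP/negPn/negP => /Jhf.
  by move=> /(frob_dividesM q u wL).
have [u [w [wL ->]]] := mnm_divn_eq L t.
move=> hfu; apply/(frob_dividesM q u wL); apply: contrapT => /(Jhf w wL).
under eq_bigr do rewrite row_coef_component //.
by rewrite -mcoeff_frobM //; exact/eqP.
Qed.

End Components.

End MonomialIdeals.

(** * Maxima of sets of naturals, pigeonhole, and base [p] digit sequences *)

(** A nonempty bounded set has a maximum, so the default value of [natmax] does not arise here. *)
Lemma leq_natmax (A : set nat) B k : A 0%N ->
  (forall i j, (i <= j)%N -> A j -> A i) -> (forall i, A i -> (i <= B)%N) ->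
  (k <= natmax A)%N <-> A k.
Proof.
move=> A0 A_down AB.
have exA : exists i, `[< A i >] by exists 0%N; apply/asboolP.
have ubA i : `[< A i >] -> (i <= B)%N by move/asboolP/AB.
have [i /asboolP Ai i_max] := ex_maxnP exA ubA.
have [Amax max_ub] : is_maximum A (natmax A).
  apply: xgetPex; exists i; split=> // j /asboolP/i_max.
  by rewrite leEnat.
split=> [kA|/max_ub]; first exact: A_down kA Amax.
by rewrite leEnat.
Qed.

Lemma infinitely_often_value (T : finType) (c : nat -> T) :
  exists t, forall E, exists2 e, (E <= e)%N & c e = t.
Proof.
apply: contrapT => noT.
have /choice[E EP] t : exists E, forall e, (E <= e)%N -> c e <> t.
  apply: contrapT => noE; apply: noT; exists t => E; apply: contrapT => noe.
  by apply: noE; exists E => e Ee ce; apply: noe; exists e.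
apply: (EP (c (\max_t E t)) (\max_t E t)) => //.
exact: leq_bigmax.
Qed.

(* The base [p] digits of [nu e] are those of [nu i] followed by the digits of
   [tail p nu i (e - i)]. *)
Definition tail p (nu : nat -> nat) i L := (nu (i + L) - nu i * p ^ L)%N.

Section Tails.
Variable p : nat.
Hypothesis p_gt0 : (0 < p)%N.
Implicit Types nu : nat -> nat.

(** Dropping the last [L] base [p] digits of [nu (e + L)] leaves [nu e]: all values are truncations
    of one infinite expansion. *)
Definition truncating nu := forall e L, (nu (e + L) %/ p ^ L = nu e)%N.

Lemma truncating_leq nu e L : truncating nu -> (nu e * p ^ L <= nu (e + L))%N.
Proof. by move=> nuT; rewrite -leq_divRL ?expn_gt0 ?p_gt0 // nuT. Qed.

Lemma tail_lt nu i L : truncating nu -> (tail p nu i L < p ^ L)%N.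
Proof.
move=> nuT; have P_gt0 : (0 < p ^ L)%N by rewrite expn_gt0 p_gt0.
rewrite /tail ltn_subLR ?truncating_leq // -(nuT i L).
by rewrite {1}(divn_eq (nu (i + L)%N) (p ^ L)) ltn_add2l ltn_pmod.
Qed.

Lemma tail_divn nu i L L' : truncating nu ->
  (tail p nu i (L + L') %/ p ^ L' = tail p nu i L)%N.
Proof.
move=> nuT; have P_gt0 : (0 < p ^ L')%N by rewrite expn_gt0 p_gt0.
rewrite /tail expnD mulnA addnA -[in RHS](nuT (i + L)%N L').
rewrite {1}(divn_eq (nu (i + L + L')%N) (p ^ L')) -addnBAC; last first.
  by rewrite leq_mul2r nuT truncating_leq ?orbT.
by rewrite -mulnBl divnMDl // (divn_small (ltn_pmod _ _)) ?addn0.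
Qed.

(** Equal tails at [i < j] make the digits eventually periodic: for [e > j], [nu e] is computed from
    [nu j], [nu i] and [nu (i + (e - j))], and the last argument is below [e]. Both sequences obey
    this recursion with the same initial values. *)
Lemma eq_repeated_tail nu nu' i j : (i < j)%N ->
  truncating nu -> truncating nu' ->
  (forall L, tail p nu i L = tail p nu j L) ->
  (forall L, tail p nu' i L = tail p nu' j L) ->
  (forall e, (e <= j)%N -> nu e = nu' e) -> nu =1 nu'.
Proof.
move=> ij nuT nuT' tnu tnu' eqj e; elim/ltn_ind: e => e IHe.
have [/eqj//|je] := leqP e j.
have expand s : truncating s -> (forall L, tail p s i L = tail p s j L) ->
    s e = (s j * p ^ (e - j) + (s (i + (e - j)) - s i * p ^ (e - j)))%N.
  move=> sT st; rewrite -/(tail p s i (e - j)) st /tail.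
  by rewrite subnKC ?truncating_leq // subnKC // ltnW.
rewrite !expand // eqj // (eqj i) 1?ltnW // IHe //.
by rewrite -[X in (_ < X)%N](subnKC (ltnW je)) ltn_add2r.
Qed.

End Tails.

(** * Finitely many digit sequences in bounded degree *)

Section Finiteness.
Variables (K : fieldType) (n : nat) (M : set (multinom n)) (p : nat).
Hypothesis charK : p \in [pchar K].
Let p_gt0 : (0 < p)%N := prime_gt0 (pcharf_prime charK).
Local Notation J e := (@frob_monomial K n M (p ^ e)).

Lemma frob_monomial_exp e L (f : mpoly n K) k :
  J (e + L) (f ^+ (k * p ^ L)) <-> J e (f ^+ k).
Proof. by rewrite expnD exprM frob_monomial_frob. Qed.

Lemma frob_monomial_leq e (f : mpoly n K) i j :
  (i <= j)%N -> J e (f ^+ i) -> J e (f ^+ j).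
Proof.
move=> ij Ji; rewrite -(subnK ij) exprD.
by have [_ _] := frob_monomial_ideal K M (p ^ e); apply.
Qed.

Definition exponent_count (f : mpoly n K) (nu : nat -> nat) :=
  forall e k, (k <= nu e)%N <-> ~ J e (f ^+ k).

(** The predicate [D] is abstract so that the argument serves both a single polynomial and [mu]. *)
Lemma truncating_count (D : nat -> nat -> Prop) (nu : nat -> nat) :
  (forall e k, (k <= nu e)%N <-> D e k) ->
  (forall e L k, D (e + L)%N (k * p ^ L)%N <-> D e k) -> truncating p nu.
Proof.
move=> nuD DL e L; have P_gt0 : (0 < p ^ L)%N by rewrite expn_gt0 p_gt0.
apply/eqP; rewrite eqn_leq; apply/andP; split.
  by apply/nuD/DL/nuD; rewrite -leq_divRL.
by rewrite leq_divRL //; apply/nuD/DL/nuD.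
Qed.

Lemma truncating_exponent_count f nu : exponent_count f nu -> truncating p nu.
Proof.
move=> fnu; apply: (truncating_count fnu) => e L k.
by split; apply: contra_not => /frob_monomial_exp; apply.
Qed.

Local Notation N d := #|{: bmultinom n d.+1}|.

(* If the tails at positions [0, ..., N] were pairwise distinct, then so would be
   their truncations [k i] to some common length [L].  For each [i] pick a
   component [v i] of [f ^+ k i] outside the colon ideal of
   [frob_monomial (p ^ i)] by [f ^+ nu i].  By maximality of [nu (i + L)] that
   colon ideal contains all components of [f ^+ k j] with [k j > k i], so the
   [v i] are [N + 1] independent vectors in a space of dimension [N]. *)
Lemma repeated_tail d f nu : mdeg_le d f -> exponent_count f nu ->
  exists i j : 'I_(N d).+1,
    (i < j)%N /\ forall L, tail p nu i L = tail p nu j L.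
Proof.
move=> fd fnu; have nuT := truncating_exponent_count fnu.
apply: contrapT => no_repeat.
have /choice[Lf LfP] (ij : 'I_(N d).+1 * 'I_(N d).+1) : exists L,
    ij.1 != ij.2 -> tail p nu ij.1 L != tail p nu ij.2 L.
  apply: contrapT => noL.
  have eq_tail L : tail p nu ij.1 L = tail p nu ij.2 L.
    by apply/eqP/negPn/negP => neqL; apply: noL; exists L.
  have : ij.1 != ij.2 by apply/negP => eq_ij; apply: noL; exists 0%N; rewrite eq_ij.
  rewrite neq_ltn => /orP[lt|lt]; apply: no_repeat.
    by exists ij.1, ij.2.
  by exists ij.2, ij.1; split=> // L; rewrite eq_tail.
pose L := (\max_ij Lf ij)%N.
pose k (i : 'I_(N d).+1) := tail p nu i L.
have k_inj : injective k.
  move=> i j; rewrite /k => kij; apply/eqP/negPn/negP => ij.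
  have := LfP (i, j) ij; rewrite /=.
  have LL : (Lf (i, j) <= L)%N by exact: leq_bigmax.
  (* Tails equal at length [L] would stay equal after truncation to the length that separates [i]
     from [j]. *)
  pose E s := tail_divn p_gt0 s (Lf (i, j)) (L - Lf (i, j)) nuT.
  by rewrite -(E i) -(E j) subnKC // kij eqxx.
have kE (i : 'I_(N d).+1) : (nu i * p ^ L + k i = nu (i + L))%N.
  by rewrite subnKC // truncating_leq.
have kd i : mdeg_le (p ^ L * d) (f ^+ k i).
  move=> u /(mdeg_le_exp fd) /leq_trans; apply.
  by rewrite leq_mul2r ltnW ?orbT // tail_lt.
have Jk (i j : 'I_(N d).+1) :
    J (i + L) (f ^+ (nu i * p ^ L + k j)) <-> forall w : multinom n,
    (forall l, w l < p ^ L)%N ->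
    colon_row M p (p ^ i) L (f ^+ nu i) (component p d L w (f ^+ k j)).
  by rewrite exprD exprM expnD; exact: frob_monomial_component.
have /choice[w wP] (i : 'I_(N d).+1) : exists w : multinom n, (forall l, w l < p ^ L)%N /\
    ~ colon_row M p (p ^ i) L (f ^+ nu i) (component p d L w (f ^+ k i)).
  have /fnu : (nu (i + L) <= nu (i + L))%N by [].
  rewrite -kE => nJ; apply: contrapT => now; apply: nJ; apply/Jk => w wL.
  by apply: contrapT => nw; apply: now; exists w.
have [|i j kij|i] := @filtered_pigeonhole K (N d)
  (fun i => component p d L (w i) (f ^+ k i))
  (fun i => colon_row M p (p ^ i) L (f ^+ nu i)) k k_inj.
- by move=> i; exact: colon_row_subspace.
- have [wL _] := wP j; apply: (proj1 (Jk i j)) wL.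
  by apply: contrapT => /fnu; rewrite -kE leq_add2l leqNgt kij.
- exact: (wP i).2.
Qed.

(** Each [nu e] is determined by its repeated positions and its values up to [N d], which are
    bounded through [mu]: finitely many data. One datum recurs for arbitrarily large [e]; the
    sequences sharing it coincide, and each agrees with [mu] at its own [e], hence at all smaller
    positions. *)
Lemma diagonal_exponent_count d (f : nat -> mpoly n K) (nu : nat -> nat -> nat)
    (mu : nat -> nat) :
  (forall e, mdeg_le d (f e)) -> (forall e, exponent_count (f e) (nu e)) ->
  (forall e i, nu e i <= mu i)%N -> (forall e, nu e e = mu e) ->
  truncating p mu -> exists e, nu e =1 mu.
Proof.
move=> fd fnu nu_le nu_diag muT.
have /choice[i iP] e := repeated_tail (fd e) (fnu e).
have /choice[j jP] := iP.
pose B := (\max_(l < (N d).+1) mu l)%N.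
pose c e := (i e, j e, [ffun l : 'I_(N d).+1 => inord (nu e l) : 'I_B.+1]).
have [t ct] := infinitely_often_value c.
have [e0 _ ce0] := ct 0%N; exists e0 => l.
have [e le ce] := ct l.
have nuT s := truncating_exponent_count (fnu s).
have eq_nu : nu e0 =1 nu e.
  have [] : c e0 = c e by rewrite ce ce0.
  move=> ei ej /ffunP eB; have [ij0 tl0] := jP e0; have [ij tl] := jP e.
  apply: (eq_repeated_tail p_gt0 ij0) => //.
    by move=> L; rewrite ei ej.
  move=> l' lj; have lN : (l' < (N d).+1)%N := leq_ltn_trans lj (ltn_ord _).
  have lB s : (nu s l' < B.+1)%N.
    by rewrite ltnS (leq_trans (nu_le _ _)) // (leq_bigmax (Ordinal lN)).
  by have := eB (Ordinal lN); rewrite !ffunE => /(congr1 val); rewrite /= !inordK.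
by rewrite -(muT l (e - l)%N) -(nuT e0 l (e - l)%N) subnKC // eq_nu nu_diag.
Qed.

End Finiteness.

Lemma truncating_cvg (R : realType) p (nu : nat -> nat) B : (0 < p)%N ->
  truncating p nu -> (forall e, nu e <= B * p ^ e)%N ->
  cvgn (fun e => (nu e)%:R / (p ^ e)%:R : R).
Proof.
move=> p_gt0 nuT nuB.
have P_gt0 e : 0 < (p ^ e)%:R :> R by rewrite ltr0n expn_gt0 p_gt0.
apply: nondecreasing_is_cvgn.
  apply/nondecreasing_seqP => e; rewrite ler_pdivrMr // mulrAC ler_pdivlMr //.
  rewrite -!natrM ler_nat expnS mulnA leq_mul2r.
  by have := truncating_leq p_gt0 e 1 nuT; rewrite expn1 addn1 => ->; rewrite orbT.
exists B%:R => _ [e _ <-]; rewrite ler_pdivrMr // -natrM ler_nat.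
exact: nuB.
Qed.

(** * Thresholds of linear combinations of the generators and the critical exponent *)

Section Thresholds.
Variables (R : realType) (p : nat) (K : fieldType) (n : nat).
Hypothesis charK : p \in [pchar K].
Hypothesis infK : infinite_set [set: K].
Let p_gt0 : (0 < p)%N := prime_gt0 (pcharf_prime charK).
Let charS : p \in [pchar (mpoly n K)]. Proof. by rewrite pchar_lalg. Qed.

Variables (m : nat) (g : 'I_m -> mpoly n K) (M : set (multinom n)).
Local Notation a := (ideal_gen (range g)).
Local Notation b := (ideal_gen [set mpolyX K u | u in M]).
Local Notation J e := (@frob_monomial K n M (p ^ e)).
Local Notation lincomb t := (\sum_(i < m) t i *: g i).

Lemma lincomb_in_ideal t : a (lincomb t).
Proof.
have [a0 aD _] := ideal_gen_ideal (range g).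
elim/big_ind: _ => // i _; apply: (@ideal_scale K (mpoly n K) a); first exact: ideal_gen_ideal.
by apply: ideal_gen_mem; exists i.
Qed.

Lemma mdeg_le_lincomb : exists d, forall t, mdeg_le d (lincomb t).
Proof.
exists (\max_i mmeasure mdeg (g i))%N => t u; rewrite raddf_sum /=.
apply: contraNT; rewrite -ltnNge => du; apply/eqP/big1 => i _.
rewrite mcoeffZ; have [->|] := eqVneq (mcoeff u (g i)) 0; first by rewrite mulr0.
rewrite -mcoeff_msupp => /msize_mdeg_lt /ltnW ug.
have gd : (mmeasure mdeg (g i) <= \max_i mmeasure mdeg (g i))%N by exact: leq_bigmax.
by have := leq_trans ug gd; rewrite leqNgt du.
Qed.

(** Polarization is applied to the linear span of the generators and not to the whole ideal, since
    the span has bounded degree. *)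
Lemma base_pow_lincomb e k :
  ~ (base_pow p a k `<=` J e) <-> exists t, ~ J e (lincomb t ^+ k).
Proof.
split=> [nsub|[t nJ] sub]; last first.
  apply: nJ; apply: sub; apply: base_pow_exp; last exact: lincomb_in_ideal.
  exact: prime_gt1 (pcharf_prime charK).
apply: contrapT => noJ; apply: nsub.
apply: (base_pow_sub infK charK (A := [set f | exists t, f = lincomb t])).
- move=> _ _ s [t ->] [t' ->]; exists (fun i => t i + s * t' i).
  by rewrite scaler_sumr -big_split; apply: eq_bigr => i _; rewrite scalerDl scalerA.
- by exists (fun=> 0); rewrite big1 // => i _; rewrite scale0r.
- exact: frob_monomial_ideal.
- move=> _ [i _ <-]; exists (fun j => (j == i)%:R).
  by rewrite (bigD1 i) //= eqxx scale1r big1 ?addr0 // => j /negPf ->; rewrite scale0r.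
- by move=> _ [t ->]; apply: contrapT => nJ; apply: noJ; exists t.
Qed.

Hypothesis b_proper : b <> setT.
Hypothesis ab : a `<=` radical b.

Lemma not_frob_monomial1 e : ~ J e 1.
Proof.
move=> /(_ mnm0); rewrite mcoeff1 eqxx oner_eq0 => /(_ isT) [u Mu u0].
apply: b_proper; apply/seteqP; split=> // f _.
have [_ _ bM] := ideal_gen_ideal [set mpolyX K u | u in M].
rewrite -[f]mulr1; apply: bM; apply: ideal_gen_mem; exists u => //.
rewrite (_ : u = mnm0) ?mpolyX0 //; apply/mnmP => i; rewrite mnm0E.
have := u0 i; rewrite mnm0E leqn0 muln_eq0 expn_eq0 -leqn0 leqNgt p_gt0 /=.
by move/eqP.
Qed.

(** Additivity of Frobenius reduces a common exponent for all of [a] to one for the finitely many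
    generators. *)
Lemma frob_pow_in_radical : exists E, forall f, a f -> b (f ^+ (p ^ E)).
Proof.
have /choice[N bN] (i : 'I_m) : exists N, b (g i ^+ N).
  by apply: ab; apply: ideal_gen_mem; exists i.
exists (\max_i N i)%N => f af; rewrite -[f ^+ _]mulr1.
have b_ideal := ideal_gen_ideal [set mpolyX K u | u in M].
apply: (ideal_gen_min (ideal_preim_pow charS 1 _ b_ideal)) af.
move=> _ [i _ <-] /=; rewrite mulr1.
have Np : (N i <= p ^ \max_i N i)%N.
  rewrite (leq_trans (leq_bigmax i)) // ltnW // ltn_expl //.
  exact: prime_gt1 (pcharf_prime charK).
by rewrite -(subnK Np) exprD; have [_ _] := b_ideal; apply.
Qed.

Lemma frob_monomial_bound : exists B, forall f, a f -> forall e k,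
  ~ J e (f ^+ k) -> (k <= B * p ^ e)%N.
Proof.
have [E bE] := frob_pow_in_radical; exists (p ^ E)%N => f af e k.
apply: contra_notT; rewrite -ltnNge => /ltnW Bk; apply: (frob_monomial_leq Bk).
apply/(frob_monomial_exp M charK 0 e).
by rewrite -frob_pow_monomial // -[_ ^+ _]expr1; apply: frob_pow_exp; exact: bE.
Qed.

(** Once [p ^ e] exceeds the degree of a monomial of [f], only the exponent 0 in [M] could put that
    monomial in the Frobenius power, and properness of [b] excludes 0 from [M]. *)
Lemma frob_monomial_small (f : mpoly n K) : f != 0 -> exists e, ~ J e f.
Proof.
move=> f0; have [u uf] : exists u, mcoeff u f != 0.
  have := mlead_supp f0; rewrite mcoeff_msupp; by exists (mlead f).
exists (mdeg u).+1 => /(_ u uf) [v Mv vu].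
apply: (@not_frob_monomial1 0) => w; rewrite mcoeff1.
have [-> _|] := eqVneq w mnm0; last by rewrite eqxx.
exists v => // i; rewrite mnm0E leqn0 muln_eq0; apply/orP; right.
rewrite -leqn0 leqNgt; apply/negP => vi.
have := leq_trans (leq_pmulr _ vi) (vu i); rewrite leqNgt => /negP; apply.
apply: leq_ltn_trans (ltn_expl _ (prime_gt1 (pcharf_prime charK))).
by rewrite (leq_trans _ (leqnSn _)) // mdegE (bigD1 i) //= leq_addr.
Qed.

Local Notation nu_ f := (fun e => nu (ideal_gen [set f]) b (p ^ e)).
Local Notation mu_ := (fun e => mu p a b (p ^ e)).

Lemma nu_exponent_count f : a f -> exponent_count M p f (nu_ f).
Proof.
move=> af e k; have [B JB] := frob_monomial_bound.
have nuE i : ~ (ideal_pow (ideal_gen [set f]) i `<=` frob_pow b (p ^ e)) <->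
    ~ J e (f ^+ i).
  rewrite frob_pow_monomial //; split; apply: contra_not => /ideal_pow1_sub;
    by apply; exact: frob_monomial_ideal.
rewrite /nu -nuE; apply: (@leq_natmax _ (B * p ^ e)).
- by apply/nuE; rewrite expr0; exact: not_frob_monomial1.
- move=> i j ij /= /nuE nJ; apply/nuE; apply: contra_not nJ.
  exact: frob_monomial_leq.
- by move=> i /= /nuE; exact: JB.
Qed.

Lemma mu_count e k : (k <= mu_ e)%N <-> exists t, ~ J e (lincomb t ^+ k).
Proof.
have [B JB] := frob_monomial_bound.
rewrite /mu -base_pow_lincomb frob_pow_monomial //.
apply: (@leq_natmax _ (B * p ^ e)).
- apply/base_pow_lincomb; exists (fun=> 0); rewrite expr0.
  exact: not_frob_monomial1.
- move=> i j ij /= /base_pow_lincomb[t nJ]; apply/base_pow_lincomb; exists t.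
  by apply: contra_not nJ; exact: frob_monomial_leq.
- move=> i /= /base_pow_lincomb[t]; apply: JB; exact: lincomb_in_ideal.
Qed.

Lemma nu_le_mu f e : a f -> (nu_ f e <= mu_ e)%N.
Proof.
move=> af; have /(nu_exponent_count af) nJ : (nu_ f e <= nu_ f e)%N by [].
apply/mu_count/base_pow_lincomb => sub; apply: nJ; apply: sub.
by apply: base_pow_exp => //; exact: prime_gt1 (pcharf_prime charK).
Qed.

Lemma truncating_mu : truncating p mu_.
Proof.
apply: (truncating_count charK mu_count) => e L k.
by split=> -[t nJ]; exists t; apply: contra_not nJ => /frob_monomial_exp; apply.
Qed.

Lemma cvg_nu f : a f -> cvgn (fun e => (nu_ f e)%:R / (p ^ e)%:R : R).
Proof.
move=> af; have [B JB] := frob_monomial_bound.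
apply: (@truncating_cvg R p (nu_ f) B) => //.
  exact: (truncating_exponent_count charK (nu_exponent_count af)).
by move=> e; apply: (JB f af); apply/(nu_exponent_count af).
Qed.

Lemma cvg_mu : cvgn (fun e => (mu_ e)%:R / (p ^ e)%:R : R).
Proof.
have [B JB] := frob_monomial_bound.
apply: (@truncating_cvg R p mu_ B) => //; first exact: truncating_mu.
move=> e; have /mu_count[t] : (mu_ e <= mu_ e)%N by [].
by apply: JB; exact: lincomb_in_ideal.
Qed.

Lemma F_threshold_le_crit f : a f ->
  F_threshold R p b (ideal_gen [set f]) <= crit_exponent R p b a.
Proof.
move=> af; apply: ler_lim; [exact: cvg_nu|exact: cvg_mu|].
by apply: nearW => e; rewrite ler_wpM2r ?invr_ge0 ?ler0n // ler_nat nu_le_mu.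
Qed.

Lemma crit_attained : (0 < m)%N -> (forall i, g i != 0) ->
  exists f, [/\ a f, f != 0 &
    F_threshold R p b (ideal_gen [set f]) = crit_exponent R p b a].
Proof.
move=> m_gt0 g_neq0.
have /choice[t tP] e : exists t, ~ J e (lincomb t ^+ mu_ e).
  exact/mu_count.
have aT e := lincomb_in_ideal (t e); have [d td] := mdeg_le_lincomb.
have [e nuE] : exists e, nu_ (lincomb (t e)) =1 mu_.
  apply: (@diagonal_exponent_count K n M p charK d (fun e => lincomb (t e))
    (fun e => nu_ (lincomb (t e)))) => //.
  - by move=> e; exact: nu_exponent_count.
  - by move=> e i; exact: nu_le_mu.
  - move=> e; apply/eqP; rewrite eqn_leq nu_le_mu //=.
    exact/(nu_exponent_count (aT e)).
  - exact: truncating_mu.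
exists (lincomb (t e)); split=> //; last first.
  by rewrite /F_threshold; under eq_fun => i do rewrite [nu _ _ _]nuE.
(* The combination is nonzero: some generator lies outside a Frobenius power of [b], so [mu_ E] is
   positive there, while every positive power of 0 lies in the ideal. *)
apply/negP => /eqP t0; pose i := Ordinal m_gt0.
have [E nJ] := frob_monomial_small (g_neq0 i).
have : (1 <= nu_ (lincomb (t e)) E)%N.
  rewrite nuE; apply/mu_count/base_pow_lincomb => sub; apply: nJ; apply: sub.
  rewrite -[g i]expr1; apply: base_pow_exp; first exact: prime_gt1 (pcharf_prime charK).
  by apply: ideal_gen_mem; exists i.
move=> /(nu_exponent_count (aT e)); rewrite t0 expr1; apply.
by have [] := frob_monomial_ideal K M (p ^ E).
Qed.

End Thresholds.

Theorem corollary5p15 (R : realType) (p : nat) (K : fieldType)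
  (charK : p \in [pchar K]) (infK : infinite_set [set: K])
  (FfinK : F_finite p K) (n m : nat) (g : 'I_m -> mpoly n K)
  (m_gt0 : (0 < m)%N) (g_neq0 : forall i, g i != 0)
  (a : set (mpoly n K)) (a_gen : a = ideal_gen (range g)) (a_proper : a <> setT)
  (b : set (mpoly n K)) (b_mon : monomial_ideal b) (b_proper : b <> setT)
  (ab : a `<=` radical b) :
  is_maximum
    [set F_threshold R p b (ideal_gen [set f]) | f in [set f | a f /\ f != 0]]
    (crit_exponent R p b a).
Proof.
have [M bE] := b_mon; move: b_proper ab; rewrite a_gen bE => b_proper' ab'.
split.
  have [f [af f0 fE]] := crit_attained R charK infK b_proper' ab' m_gt0 g_neq0.
  by exists f.
by move=> _ [f [af f0] <-]; exact: F_threshold_le_crit.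
Qed.
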